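(* Let $B>0$ and $\alpha_m=(m+1)/(m+2)$ for $m\ge0$. Suppose a sequence $\{b_m\}_{m\ge0}$ of real numbers satisfies $$b_{m+1}\le\alpha_m^{1/2}b_m+\frac{B}{(m+2)^{1/2}}\qquad\text{for all } m\ge0,$$ and $$b_{m+1}\le\alpha_m^{1/2}\left(b_m+\frac{1}{(m+1)b_m}\right)\qquad\text{for all } m\ge 0 \text{ with } b_m>0.$$ Fix a constant $A\ge B/\sqrt2+\sqrt2$. Then $b_0\le A$ implies $b_m\le A$ for all $m\ge1$. In particular, if $B\le1/\sqrt2$, one can choose $A=2$. *)

(* Defs.v *)
From Stdlib Require Import Reals.
Open Scope R_scope.

Definition alpha (m : nat) : R := (INR m + 1) / (INR m + 2).

(* Main.v *)
Require Import Defs.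
From Stdlib Require Import Reals Lra.
Open Scope R_scope.

(** Write p = sqrt (m+1) and q = sqrt (m+2), so that (q - p)(q + p) = 1 and the
    two recursions read q b' <= p b + B and q b' <= p b + 1/(p b).  The second
    one preserves the bound A only if p A^2 >= p + q, which is slightly more
    than A^2 >= 2.  If p A^2 < p + q, then A exceeds sqrt 2 so little
    that A >= B / sqrt 2 + sqrt 2 forces B <= (q - p) A, and the first
    recursion alone gives q b' <= q A. *)

Lemma add_inv_increasing (x y : R) : 1 <= x -> x <= y -> x + / x <= y + / y.
Proof.
  intros Hx Hxy.
  assert (E : y + / y - (x + / x) = (y - x) * (1 - / (x * y))) by (field; lra).
  assert (/ (x * y) <= 1) by (rewrite <- Rinv_1; apply Rinv_le_contravar; nra).
  nra.
Qed.

Lemma sqrt_two_bounds : 0 < sqrt 2 /\ sqrt 2 * sqrt 2 = 2 /\ 1 < sqrt 2 <= 3 / 2.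
Proof.
  assert (H := sqrt_sqrt 2 ltac:(lra)).
  assert (H0 := sqrt_lt_R0 2 ltac:(lra)).
  repeat split; nra.
Qed.

(** One induction step, with [x] and [y] for consecutive terms and both recursions multiplied by
    [q]. Of the square roots only [q * q = p * p + 1] and [1 <= p] remain. *)
Lemma recursion_step (p q A B x y : R) :
  1 <= p -> 0 < q -> q * q = p * p + 1 -> 0 < B ->
  B / sqrt 2 + sqrt 2 <= A ->
  q * y <= p * x + B ->
  (0 < x -> q * y <= p * x + / (p * x)) ->
  x <= A -> y <= A.
Proof.
  intros Hp Hq Hpq HB HA H1 H2 Hx.
  destruct sqrt_two_bounds as (Hs0 & Hss & Hs1 & Hs2).
  remember (sqrt 2) as s eqn:Es; clear Es.
  assert (HBs : 0 < B / s) by (apply Rdiv_lt_0_compat; lra).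
  assert (EB : B = s * (B / s)) by (field; lra).
  remember (B / s) as t eqn:Et; clear Et.
  assert (Hlt : p < q) by nra.
  assert (Hqs : s <= q) by nra.
  apply Rmult_le_reg_l with q; [lra|].
  (* Since [(q - p) * (q + p) = 1], the first case says exactly that
     [p * A + / (p * A) <= q * A]. *)
  destruct (Rle_lt_dec (p + q) (p * (A * A))) as [Hbig|Hsmall].
  (* For [x <= s] the first recursion suffices, as [B = s * t] and [s + t <= A]. For [x > s],
     [p * x > 1] lies where [u + / u] increases. *)
  - destruct (Rle_lt_dec x s) as [Hxs|Hxs].
    + assert (p * x <= q * s) by nra.
      assert (B <= q * t) by nra.
      nra.
    + specialize (H2 ltac:(lra)).
      assert (Hmon : p * x + / (p * x) <= p * A + / (p * A))
        by (apply add_inv_increasing; nra).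
      assert (HpA : 0 < p * A) by nra.
      assert (Hinv : / (p * A) <= (q - p) * A).
      { apply Rmult_le_reg_l with (p * A); [lra|].
        rewrite Rinv_r by lra.
        assert ((q - p) * (p + q) <= (q - p) * (p * (A * A)))
          by (apply Rmult_le_compat_l; lra).
        nra. }
      lra.
  - assert (HAs : s <= A) by lra.
    assert (Hd : A * A - 2 <= q - p).
    { assert (p * (A * A - 2) < q - p) by lra. nra. }
    (* Factoring [A * A - 2 = (A - s) * (A + s)] with [s <= A] gives [2 * B <= q - p], and
       [A > 1]. *)
    assert (HBd : B <= (q - p) * A).
    { assert (B <= s * (A - s)) by nra.
      assert (2 * s * (A - s) <= A * A - 2) by nra.
      nra. }
    nra.
Qed.

Lemma sqrt_alpha (m : nat) :
  sqrt (alpha m) = sqrt (INR m + 1) / sqrt (INR m + 2).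
Proof.
  unfold alpha; assert (H := pos_INR m).
  apply sqrt_div; lra.
Qed.

Theorem lemma3 (B : R) (b : nat -> R)
  (hB : 0 < B)
  (h1 : forall m : nat,
      b (S m) <= sqrt (alpha m) * b m + B / sqrt (INR m + 2))
  (h2 : forall m : nat, 0 < b m ->
      b (S m) <= sqrt (alpha m) * (b m + 1 / ((INR m + 1) * b m))) :
  (forall A : R, A >= B / sqrt 2 + sqrt 2 ->
     b 0%nat <= A -> forall m : nat, (1 <= m)%nat -> b m <= A)
  /\
  (B <= 1 / sqrt 2 ->
     2 >= B / sqrt 2 + sqrt 2 /\
     (b 0%nat <= 2 -> forall m : nat, (1 <= m)%nat -> b m <= 2)).
Proof.
  assert (Hall : forall A : R, A >= B / sqrt 2 + sqrt 2 ->
            b 0%nat <= A -> forall m : nat, b m <= A).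
  { intros A HA H0 m; induction m as [|m IH]; [exact H0|].
    specialize (h1 m); specialize (h2 m).
    rewrite sqrt_alpha in h1, h2.
    assert (Hm := pos_INR m).
    assert (Hpp := sqrt_sqrt (INR m + 1) ltac:(lra)).
    assert (Hqq := sqrt_sqrt (INR m + 2) ltac:(lra)).
    assert (Hp := sqrt_lt_R0 (INR m + 1) ltac:(lra)).
    assert (Hq := sqrt_lt_R0 (INR m + 2) ltac:(lra)).
    (* The first occurrence of [INR m + 1] is under the root and must stay. *)
    rewrite <- Hpp in h2 at 2.
    remember (sqrt (INR m + 1)) as p eqn:Ep; clear Ep.
    remember (sqrt (INR m + 2)) as q eqn:Eq; clear Eq.
    apply (recursion_step p q A B (b m) (b (S m))); try nra.
    - replace (p * b m + B) with (q * (p / q * b m + B / q)) by (field; lra).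
      apply Rmult_le_compat_l; lra.
    - intros Hb; specialize (h2 Hb).
      replace (p * b m + / (p * b m))
        with (q * (p / q * (b m + 1 / (p * p * b m)))) by (field; lra).
      apply Rmult_le_compat_l; lra. }
  split.
  - intros A HA H0 m _; exact (Hall A HA H0 m).
  - intros HB.
    assert (H2 : 2 >= B / sqrt 2 + sqrt 2).
    { destruct sqrt_two_bounds as (Hs0 & Hss & _ & Hs2).
      (* With [sqrt 2 <= 3 / 2] the sum is at most 2. *)
      assert (B / sqrt 2 <= 1 / 2).
      { replace (1 / 2) with (1 / sqrt 2 / sqrt 2)
          by (replace (1 / 2) with (1 / (sqrt 2 * sqrt 2)) by (rewrite Hss; reflexivity);
              field; lra).
        apply Rmult_le_compat_r; [left; apply Rinv_0_lt_compat; lra | exact HB]. }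
      lra. }
    split; [exact H2|].
    intros H0 m _; exact (Hall 2 H2 H0 m).
Qed.
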